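(* Let $X$ and $Y$ be (nonzero) Banach spaces over the same scalar field $\mathbb{K}\in\{\mathbb{R},\mathbb{C}\}$ and let $N$ be an absolute normalised norm on $\mathbb{R}^2$ different from the $\ell_\infty$-norm $(a,b)\mapsto\max\{|a|,|b|\}$. If $X\oplus_N Y$ has the convex-DLD2P, then both $X$ and $Y$ have the convex-DLD2P.
   Context: For a Banach space $X$, $B_X$, $S_X$ and $X^*$ denote the closed unit ball, the unit sphere and the topological dual of $X$. Given $x^*\in B_{X^*}$ and $\alpha>0$, the slice of $B_X$ produced by $x^*$ and $\alpha$ is $S(B_X,x^*,\alpha)=\{x\in B_X : \operatorname{Re} x^*(x)>1-\alpha\}$. A point $x\in S_X$ is a $\Delta$-point (in $X$) if for every slice $S$ of $B_X$ with $x\in S$ and for every $\varepsilon>0$ there is some $y\in S$ such that $\|x-y\|\geq 2-\varepsilon$. The space $X$ has the convex-DLD2P (convex diametral local diameter two property) if $B_X$ is the closed convex hull of the set of $\Delta$-points of $X$; equivalently, if every non-empty slice of $B_X$ contains a $\Delta$-point. An absolute normalised norm on $\mathbb{R}^2$ is a norm $N$ on $\mathbb{R}^2$ such that $N(a,b)=N(|a|,|b|)$ for all $(a,b)\in\mathbb{R}^2$ and $N(1,0)=N(0,1)=1$. Given Banach spaces $X,Y$ and such an $N$, the absolute sum $X\oplus_N Y$ is the product space $X\times Y$ endowed with the norm $\|(x,y)\|_N=N(\|x\|,\|y\|)$. *)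

(* Defs.v *)
From HB Require Import structures.
From mathcomp Require Import all_boot all_order all_algebra.
From mathcomp Require Import complex.
From mathcomp Require Import all_classical all_reals all_analysis.
From mathcomp Require Import ring lra.

Set Implicit Arguments.
Unset Strict Implicit.
Unset Printing Implicit Defensive.

Import Order.TTheory GRing.Theory Num.Theory.
Import numFieldNormedType.Exports.

Local Open Scope classical_set_scope.
Local Open Scope ring_scope.

Variant scalar_kind := RealScalars | ComplexScalars.

Definition scalars (R : realType) (k : scalar_kind) : numFieldType :=
  match k with
  | RealScalars => R
  | ComplexScalars => R[i]
  end.

Definition re_scalar (R : realType) (k : scalar_kind) : scalars R k -> R :=
  match k with
  | RealScalars => fun z => z
  | ComplexScalars => fun z => complex.Re z
  end.

Definition of_real (R : realType) (k : scalar_kind) : R -> scalars R k :=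
  match k with
  | RealScalars => fun r => r
  | ComplexScalars => fun r => real_complex R r
  end.

(* In a normedModType over K the norm takes its values in K itself; rnorm is
   the same norm seen as a real number (see rnormE). *)
Definition rnorm (R : realType) (k : scalar_kind)
  (X : normedModType (scalars R k)) (x : X) : R := re_scalar `|x|.

Section scalars_theory.
Variables (R : realType) (k : scalar_kind).
Implicit Types (r s : R) (z : scalars R k).

Lemma of_realK : cancel (@of_real R k) (@re_scalar R k).
Proof. by case: k. Qed.

Lemma of_real0 : of_real k 0 = 0 :> scalars R k.
Proof. by case: k. Qed.

Lemma of_realD r s : of_real k (r + s) = of_real k r + of_real k s.
Proof. by case: k => //=; rewrite rmorphD. Qed.

Lemma of_realM r s : of_real k (r * s) = of_real k r * of_real k s.
Proof. by case: k => //=; rewrite rmorphM. Qed.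

Lemma ler_of_real r s : (of_real k r <= of_real k s) = (r <= s).
Proof. by case: k => //=; rewrite lecR. Qed.

Lemma re_scalarK z : 0 <= z -> of_real k (re_scalar z) = z.
Proof. by case: k z => //= z /ger0_Im z0; case: z z0 => a b /= ->. Qed.

Lemma rnormE (X : normedModType (scalars R k)) (x : X) :
  of_real k (rnorm x) = `|x|.
Proof. exact: re_scalarK. Qed.

Lemma rnorm_ge0 (X : normedModType (scalars R k)) (x : X) : 0 <= rnorm x.
Proof. by rewrite -(ler_of_real) of_real0 rnormE. Qed.

End scalars_theory.

Section diametral.
Variables (R : realType) (k : scalar_kind) (X : normedModType (scalars R k)).
Local Notation K := (scalars R k).

Definition unit_ball : set X := [set x | rnorm x <= 1].

Definition unit_sphere : set X := [set x | rnorm x = 1].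

Definition dual_ball : set {linear X -> K^o} :=
  [set f | continuous f /\ forall x, unit_ball x -> `|f x| <= 1].

Definition slice (f : {linear X -> K^o}) (alpha : R) : set X :=
  [set x | unit_ball x /\ 1 - alpha < re_scalar (f x : K)].

Definition Delta_point : set X :=
  [set x | unit_sphere x /\
    forall (f : {linear X -> K^o}) (alpha : R), dual_ball f -> 0 < alpha ->
      slice f alpha x ->
      forall eps : R, 0 < eps ->
        exists2 y, slice f alpha y & 2 - eps <= rnorm (x - y)].

(* A convexity weight l : {i01 K} satisfies 0 <= l <= 1 in K, which for
   K = R[i] forces l to be real: convex_set is the usual (real) convexity. *)
Definition closed_convex_hull (A : set X) : set X :=
  smallest [set C : set X | closed C /\ convex_set (C : set (convex_lmodType X))] A.

Definition convex_DLD2P : Prop := unit_ball = closed_convex_hull Delta_point.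

End diametral.

Arguments convex_DLD2P {R k} X.

Record abs_norm (R : realType) := AbsNorm {
  abs_norm_fun :> R -> R -> R;
  abs_normD : forall a b c d,
    abs_norm_fun (a + c) (b + d) <= abs_norm_fun a b + abs_norm_fun c d;
  abs_normZ : forall t a b,
    abs_norm_fun (t * a) (t * b) = `|t| * abs_norm_fun a b;
  abs_norm_eq0 : forall a b, abs_norm_fun a b = 0 -> a = 0 /\ b = 0;
  abs_norm_abs : forall a b, abs_norm_fun a b = abs_norm_fun `|a| `|b|;
  abs_norm10 : abs_norm_fun 1 0 = 1;
  abs_norm01 : abs_norm_fun 0 1 = 1
}.

Section abs_norm_theory.
Variables (R : realType) (N : abs_norm R).

Lemma abs_normNl a b : N (- a) b = N a b.
Proof. by rewrite abs_norm_abs normrN -abs_norm_abs. Qed.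

Lemma abs_normNr a b : N a (- b) = N a b.
Proof. by rewrite abs_norm_abs normrN -abs_norm_abs. Qed.

Lemma abs_norm_lel a b c : 0 <= a <= c -> N a b <= N c b.
Proof.
move=> /andP[a0 ac]; have [c0|c0] := eqVneq c 0.
  by have -> : a = c by lra.
have cp : 0 < c by lra.
pose l := (1 + a / c) / 2; pose m := (1 - a / c) / 2.
have ac1 : 0 <= a / c <= 1.
  by rewrite divr_ge0 ?(ltW cp)//= ler_pdivrMr // mul1r.
have l0 : 0 <= l by rewrite /l; lra.
have m0 : 0 <= m by rewrite /m; lra.
have -> : N a b = N (l * c + m * (- c)) (l * b + m * b).
  by congr (N _ _); rewrite /l /m; field.
apply: (le_trans (abs_normD _ _ _ _ _)).
rewrite !abs_normZ abs_normNl (ger0_norm l0) (ger0_norm m0) -mulrDl.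
by have -> : l + m = 1 by [rewrite /l /m; field]; rewrite mul1r.
Qed.

Lemma abs_norm_ler a b d : 0 <= b <= d -> N a b <= N a d.
Proof.
move=> /andP[b0 bd]; have [d0|d0] := eqVneq d 0.
  by have -> : b = d by lra.
have dp : 0 < d by lra.
pose l := (1 + b / d) / 2; pose m := (1 - b / d) / 2.
have bd1 : 0 <= b / d <= 1.
  by rewrite divr_ge0 ?(ltW dp)//= ler_pdivrMr // mul1r.
have l0 : 0 <= l by rewrite /l; lra.
have m0 : 0 <= m by rewrite /m; lra.
have -> : N a b = N (l * a + m * a) (l * d + m * (- d)).
  by congr (N _ _); rewrite /l /m; field.
apply: (le_trans (abs_normD _ _ _ _ _)).
rewrite !abs_normZ abs_normNr (ger0_norm l0) (ger0_norm m0) -mulrDl.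
by have -> : l + m = 1 by [rewrite /l /m; field]; rewrite mul1r.
Qed.

Lemma abs_norm_le a b c d : 0 <= a <= c -> 0 <= b <= d -> N a b <= N c d.
Proof.
by move=> ac bd; apply: le_trans (abs_norm_lel _ ac) (abs_norm_ler _ bd).
Qed.

End abs_norm_theory.

(* An alias of X * Y, so that it does not inherit the max norm which the
   library puts on products. *)
Definition abs_sum (R : realType) (k : scalar_kind) (N : abs_norm R)
  (X Y : normedModType (scalars R k)) : Type := (X * Y)%type.

Section abs_sum_normed.
Variables (R : realType) (k : scalar_kind) (N : abs_norm R).
Variables (X Y : normedModType (scalars R k)).
Local Notation K := (scalars R k).

HB.instance Definition _ := GRing.Lmodule.copy (abs_sum N X Y) (X * Y)%type.

Definition abs_sum_norm (p : abs_sum N X Y) : K :=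
  of_real k (N (rnorm p.1) (rnorm p.2)).

Let rnormD (Z : normedModType K) (x y : Z) : rnorm (x + y) <= rnorm x + rnorm y.
Proof. by rewrite -(ler_of_real k) of_realD !rnormE ler_normD. Qed.

Let rnormZ (Z : normedModType K) (l : K) (x : Z) :
  rnorm (l *: x) = rnorm (l : K^o) * rnorm x.
Proof.
by apply: (can_inj (@of_realK R k)); rewrite of_realM !rnormE normrZ.
Qed.

Let rnorm0_eq0 (Z : normedModType K) (x : Z) : rnorm x = 0 -> x = 0.
Proof. by move=> x0; apply: normr0_eq0; rewrite -rnormE x0 of_real0. Qed.

Let abs_sum_normD (p q : abs_sum N X Y) :
  abs_sum_norm (p + q) <= abs_sum_norm p + abs_sum_norm q.
Proof.
rewrite /abs_sum_norm -of_realD ler_of_real.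
apply: le_trans (abs_normD N _ _ _ _).
by apply: abs_norm_le; rewrite rnorm_ge0 rnormD.
Qed.

Let abs_sum_normZ (l : K) (p : abs_sum N X Y) :
  abs_sum_norm (l *: p) = `|l| * abs_sum_norm p.
Proof.
rewrite /abs_sum_norm !rnormZ abs_normZ ger0_norm ?rnorm_ge0 //.
by rewrite of_realM rnormE.
Qed.

Let abs_sum_norm0_eq0 (p : abs_sum N X Y) : abs_sum_norm p = 0 -> p = 0.
Proof.
rewrite /abs_sum_norm -(of_real0 R k) => /(can_inj (@of_realK R k)).
move=> /abs_norm_eq0[/rnorm0_eq0 p1 /rnorm0_eq0 p2].
by apply/eqP; rewrite -pair_eqE /= p1 p2 !eqxx.
Qed.

HB.instance Definition _ := Lmodule_isNormed.Build K (abs_sum N X Y)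
  abs_sum_normD abs_sum_normZ abs_sum_norm0_eq0.

Lemma rnorm_abs_sum (p : abs_sum N X Y) : rnorm p = N (rnorm p.1) (rnorm p.2).
Proof. exact: of_realK. Qed.

End abs_sum_normed.

(* Main.v *)
Require Import Defs.
From HB Require Import structures.
From mathcomp Require Import all_boot all_order all_algebra.
From mathcomp Require Import complex.
From mathcomp Require Import all_classical all_reals all_analysis.
From mathcomp Require Import ring lra.
Import Order.TTheory GRing.Theory Num.Theory.
Import numFieldNormedType.Exports.

(** By symmetry it suffices to treat X. Everything rests on one statement
    about a single point ([Delta_point_fst]): if p = (x, y) is a Delta-point of
    the sum and ||y|| < 1, then x / ||x|| is a Delta-point of X.

    To see why, let a = ||x|| and let g be a norming functional of p. Its
    restriction to X has norm c with g(x, 0) = c a, and c > 0 because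
    g(0, y) <= ||y|| < 1. Given a slice {Re f > 1 - al} of the ball of X that
    contains x / a, tilt g slightly by the functional
    u |-> f u - (1 - al) g(u, 0) / c, which is positive at x. The tilted
    functional defines a slice around p, all of whose points (u, v) satisfy
    Re f u > (1 - al) ||u||, with ||u|| bounded below by a constant which
    depends only on x, f and al ([slice_estimate]). Hence w = u / ||u|| stays
    in the given slice, with no loss on al even when ||u|| < a. Take (u, v) in
    that slice almost diametral to p. Were w not almost diametral to x / a,
    then ||x - u|| would fall short of a + ||u|| by a fixed amount, and,
    because ||y|| < 1, the norm N would notice it: N is strictly increasing in
    its first argument, quantitatively, below the level 1 of the second one
    ([abs_norm_gap]). That contradicts the choice of (u, v).

    The hypothesis on N enters as N(1, 1) > 1: a point (x, y) of the unit
    sphere with ||x|| close to 1 then has ||y|| < 1 ([snd_lt1]). So a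
    Delta-point of the sum lying deep in a slice defined by a functional f of X
    produces a Delta-point of X close to its first coordinate.
    To pass to closed convex hulls, let C be the hull of the Delta-points of X,
    ||x|| = 1 and f a norming functional of x. The convex Lipschitz function
    p |-> dist(p.1, C) + (2 / d) Re f(p.1) is at most d + 2 / d at every
    Delta-point p of the sum, hence on their closed convex hull, hence at
    (x, 0); this says dist(x, C) <= d ([convex_DLD2P_fst]).

    Norming functionals come from Zorn's lemma: a sublinear functional minimal
    below the norm is automatically real-linear. *)

Set Implicit Arguments.
Unset Strict Implicit.
Unset Printing Implicit Defensive.

Local Open Scope classical_set_scope.
Local Open Scope ring_scope.

(** * Real parts, real norms and convex hulls *)

Section scalars.
Variables (R : realType) (k : scalar_kind).
Implicit Types (r s : R) (z w : scalars R k).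

Lemma re_scalarD z w : re_scalar (z + w) = re_scalar z + re_scalar w.
Proof. by case: k z w => //= -[a b] [c d]. Qed.

Lemma re_scalarN z : re_scalar (- z) = - re_scalar z.
Proof. by case: k z => //= -[a b]. Qed.

Lemma re_scalarZ r z : re_scalar (of_real k r * z) = r * re_scalar z.
Proof. by case: k z => //= -[a b] /=; rewrite mul0r subr0. Qed.

Lemma of_real1 : of_real k 1 = 1 :> scalars R k.
Proof. by case: k. Qed.

Lemma of_realN r : of_real k (- r) = - of_real k r.
Proof. by case: k => //=; rewrite rmorphN. Qed.

Lemma ltr_of_real r s : (of_real k r < of_real k s) = (r < s).
Proof. by case: k => //=; rewrite ltcR. Qed.

Lemma re_scalar_le_norm z : re_scalar z <= re_scalar `|z|.
Proof.
case: k z => [z|[a b]] /=; first exact: ler_norm.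
rewrite (le_trans (ler_norm a))// -sqrtr_sqr ler_sqrt; last first.
  by rewrite addr_ge0 ?sqr_ge0.
by rewrite lerDl sqr_ge0.
Qed.

End scalars.

Section norm.
Variables (R : realType) (k : scalar_kind) (X : normedModType (scalars R k)).
Local Notation K := (scalars R k).
Implicit Types (x y : X) (r s : R).

Lemma rnormD x y : rnorm (x + y) <= rnorm x + rnorm y.
Proof. by rewrite -(ler_of_real k) of_realD !rnormE ler_normD. Qed.

Lemma rnormN x : rnorm (- x) = rnorm x.
Proof. by rewrite /rnorm normrN. Qed.

Lemma rnorm0 : rnorm (0 : X) = 0.
Proof. by rewrite /rnorm normr0 -(of_real0 R k) of_realK. Qed.

Lemma rnorm_eq0 x : rnorm x = 0 -> x = 0.
Proof. by move=> x0; apply: normr0_eq0; rewrite -rnormE x0 of_real0. Qed.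

Lemma norm_of_real r : `|of_real k r| = of_real k `|r| :> K.
Proof.
have [r0|r0] := leP 0 r.
  by rewrite ger0_norm ?(ger0_norm r0)// -(of_real0 R k) ler_of_real.
by rewrite ltr0_norm ?(ltr0_norm r0) ?of_realN// -(of_real0 R k) ltr_of_real.
Qed.

Lemma rnormZ r x : rnorm (of_real k r *: x) = `|r| * rnorm x.
Proof.
by apply: (can_inj (@of_realK R k)); rewrite of_realM !rnormE normrZ norm_of_real.
Qed.

(** The zero vector is covered too, which lets homogeneity arguments avoid a
    case distinction. *)
Lemma unit_ballZ x : exists2 u : X, unit_ball u & of_real k (rnorm x) *: u = x.
Proof.
have [x0|x0] := eqVneq (rnorm x) 0.
  exists 0; first by rewrite /unit_ball /= rnorm0.
  by rewrite scaler0 (rnorm_eq0 x0).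
exists (of_real k (rnorm x)^-1 *: x).
  by rewrite /unit_ball /= rnormZ ger0_norm ?invr_ge0 ?rnorm_ge0// mulVf.
by rewrite scalerA -of_realM divff// of_real1 scale1r.
Qed.

Lemma re_linearD (f : {linear X -> K^o}) x y :
  re_scalar (f (x + y) : K) = re_scalar (f x : K) + re_scalar (f y : K).
Proof. by rewrite linearD re_scalarD. Qed.

Lemma re_linearN (f : {linear X -> K^o}) x :
  re_scalar (f (- x) : K) = - re_scalar (f x : K).
Proof. by rewrite linearN re_scalarN. Qed.

Lemma re_linearZ (f : {linear X -> K^o}) r x :
  re_scalar (f (of_real k r *: x) : K) = r * re_scalar (f x : K).
Proof. by rewrite linearZ /= re_scalarZ. Qed.

(** Multiplying x by a scalar of modulus 1 turns f x into its modulus, so the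
    real part alone controls f. *)
Lemma dual_ballP (f : {linear X -> K^o}) :
  dual_ball f <-> forall x, re_scalar (f x : K) <= rnorm x.
Proof.
split=> [[_ f1] x|f1].
  have [u u1 xu] := unit_ballZ x.
  rewrite -[X in f X]xu re_linearZ ler_piMr ?rnorm_ge0//.
  rewrite (le_trans (re_scalar_le_norm _))// -(ler_of_real k) of_real1 re_scalarK//.
  exact: f1.
have f_le x : `|f x| <= `|x|.
  have [->|fx0] := eqVneq (f x) 0; first by rewrite normr0.
  pose t : K := `|f x : K| / (f x : K).
  have t1 : `|t| = 1 by rewrite normf_div normr_id divff// normr_eq0.
  have ftx : (f (t *: x) : K) = `|f x : K| by rewrite linearZ; apply: mulfVK.
  have := f1 (t *: x); rewrite ftx -(ler_of_real k) re_scalarK// rnormE.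
  by rewrite normrZ t1 mul1r.
split=> [|x x1].
  apply: bounded_linear_continuous; apply/linear_boundedP.
  exists 1; split=> [|r /ltW r1 x]; first by rewrite realE ler01.
  by rewrite (le_trans (f_le x))// ler_peMl.
by rewrite (le_trans (f_le x))// -rnormE -of_real1 ler_of_real.
Qed.

(** Replaces balls, whose radii live in K, by inequalities between reals. *)
Lemma closed_rnormP (C : set X) :
  closed C <-> forall x, (forall e, 0 < e -> exists2 y, C y & rnorm (x - y) < e) -> C x.
Proof.
split=> [cC x Cx|Cx x clx].
  apply: cC => B /nbhs_normP[e /= e0 eB].
  have ee : of_real k (re_scalar e) = e by rewrite re_scalarK// ltW.
  have [|y Cy xy] := Cx (re_scalar e); first by rewrite -(ltr_of_real k) ee of_real0.
  exists y; split => //; apply: eB => /=.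
  by rewrite -rnormE -ee ltr_of_real.
apply: Cx => e e0.
have [|y [Cy xy]] := clx (ball x (of_real k e)).
  by apply: nbhsx_ballx; rewrite -(of_real0 R k) ltr_of_real.
exists y => //; move: xy; rewrite -ball_normE /=.
by rewrite -rnormE ltr_of_real.
Qed.

(** A weight l with 0 <= l <= 1 in K is real, also when K = R[i]. *)
Lemma convex_set_realP (C : set X) :
  convex_set (C : set (convex_lmodType X)) <->
  forall x y r, C x -> C y -> 0 <= r <= 1 ->
    C (of_real k r *: x + of_real k (1 - r) *: y).
Proof.
split=> cC.
  move=> x y r /mem_set Cx /mem_set Cy /andP[r0 r1].
  have Kr0 : 0 <= of_real k r by rewrite -(of_real0 R k) ler_of_real.
  have Kr1 : of_real k r <= 1 by rewrite -of_real1 ler_of_real.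
  rewrite of_realD of_realN of_real1.
  exact: (set_mem (cC x y (Itv01 Kr0 Kr1) Cx Cy)).
move=> x y l /set_mem Cx /set_mem Cy; apply/mem_set.
have lr : of_real k (re_scalar l%:num) = l%:num by rewrite re_scalarK.
have r01 : 0 <= re_scalar l%:num <= 1.
  by rewrite -!(ler_of_real k) lr of_real0 of_real1; apply/andP; split.
by have := cC x y _ Cx Cy r01; rewrite of_realD of_realN of_real1 lr.
Qed.

Lemma closed_convex_hull_sub (A D : set X) : closed D ->
  convex_set (D : set (convex_lmodType X)) -> A `<=` D -> closed_convex_hull A `<=` D.
Proof. by move=> cD vD; apply: smallest_sub. Qed.

Lemma sub_closed_convex_hull (A : set X) : A `<=` closed_convex_hull A.
Proof. exact: sub_gen_smallest. Qed.

Lemma closed_closed_convex_hull (A : set X) : closed (closed_convex_hull A).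
Proof.
apply/closed_rnormP => x Ax D [[cD vD] AD]; move/closed_rnormP: (cD); apply => e e0.
by have [y Ay xy] := Ax e e0; exists y => //; apply: Ay.
Qed.

Lemma convex_closed_convex_hull (A : set X) :
  convex_set (closed_convex_hull A : set (convex_lmodType X)).
Proof.
apply/convex_set_realP => x y r Ax Ay r01 D [[cD vD] AD].
move/convex_set_realP: (vD); apply => //.
- exact: Ax.
- exact: Ay.
Qed.

End norm.

(** * Norming functionals *)

Section sublinear.
Variables (R : realType) (k : scalar_kind) (X : normedModType (scalars R k)).
Local Notation K := (scalars R k).
Local Notation "r %:K" := (of_real k r) (at level 1, left associativity, format "r %:K").
Implicit Types (x y a : X) (r s t : R) (p q : X -> R) (F : set (X -> R)).

(** The inequality in the homogeneity clause is easier to pass to infima; it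
    implies equality, see [sublinearZ]. *)
Definition sublinear p :=
  (forall x y, p (x + y) <= p x + p y) /\
  (forall r x, 0 <= r -> p (r%:K *: x) <= r * p x).

Lemma sublinearZ p r x : sublinear p -> 0 <= r -> p (r%:K *: x) = r * p x.
Proof.
move=> [pD pZ] r0; apply/eqP; rewrite eq_le pZ//=.
have [->|rn0] := eqVneq r 0.
  rewrite mul0r of_real0 scale0r; have := pD 0 0; rewrite addr0; lra.
have rp : 0 < r by rewrite lt_neqAle eq_sym rn0.
rewrite -ler_pdivlMl// (le_trans _ (pZ _ _ _)) ?invr_ge0//.
by rewrite scalerA -of_realM mulVf// of_real1 scale1r.
Qed.

Lemma sublinear0 p : sublinear p -> p 0 = 0.
Proof. by move=> sp; have := @sublinearZ p 0 0 sp (lexx _); rewrite scaler0 mul0r. Qed.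

Lemma sublinear_ge p x : sublinear p -> - p (- x) <= p x.
Proof.
by move=> sp; have := sp.1 x (- x); rewrite subrr sublinear0//; lra.
Qed.

Definition pointwise_inf F x := inf [set f x | f in F].

Lemma pointwise_inf_le F f x : (exists b, forall g, F g -> b <= g x) -> F f ->
  pointwise_inf F x <= f x.
Proof.
move=> [b bF] Ff; apply: ge_inf; last by exists f.
by exists b => _ [g Fg <-]; apply: bF.
Qed.

Lemma le_pointwise_inf F b x : F !=set0 -> (forall f, F f -> b <= f x) ->
  b <= pointwise_inf F x.
Proof.
move=> [f Ff] bF; apply: lb_le_inf; first by exists (f x), f.
by move=> _ [g Fg <-]; apply: bF.
Qed.

(** The two conditions on F require only that sums and multiples of values be
    dominated by a value of some third member. This covers both a chain of
    sublinear functionals and the translates in [directional_inf], whose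
    members need not be sublinear. *)
Lemma sublinear_pointwise_inf F : F !=set0 ->
  (forall x, exists b, forall g, F g -> b <= g x) ->
  (forall f g x y, F f -> F g -> exists2 h, F h & h (x + y) <= f x + g y) ->
  (forall f r x, F f -> 0 <= r -> exists2 h, F h & h (r%:K *: x) <= r * f x) ->
  sublinear (pointwise_inf F).
Proof.
move=> F0 Fb FD FZ; split=> [x y|r x r0].
  rewrite -lerBlDr; apply: le_pointwise_inf => // f Ff; rewrite lerBlDl -lerBlDr.
  apply: le_pointwise_inf => // g Fg; rewrite lerBlDr [leRHS]addrC.
  have [h Fh hfg] := FD _ _ x y Ff Fg.
  by apply: le_trans hfg; apply: pointwise_inf_le.
have [rz|rn0] := eqVneq r 0.
  have [f Ff] := F0; have [h Fh hf] := FZ f r x Ff r0.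
  have -> : r * pointwise_inf F x = r * f x by rewrite rz !mul0r.
  by apply: le_trans hf; apply: pointwise_inf_le.
have rp : 0 < r by rewrite lt_neqAle eq_sym rn0.
rewrite -ler_pdivrMl//; apply: le_pointwise_inf => // f Ff; rewrite ler_pdivrMl//.
have [h Fh hf] := FZ f r x Ff r0.
by apply: le_trans hf; apply: pointwise_inf_le.
Qed.

(** The difference p (x + t a) - t p a is nonincreasing in t, so this infimum
    is its limit as t tends to +oo: a sublinear functional below p that is
    additive along the line spanned by a. *)
Definition directional_inf p a : X -> R :=
  pointwise_inf [set f | exists2 t, 0 <= t & f = fun x => p (x + t%:K *: a) - t * p a].

Let directional_lb p a x f : sublinear p ->
  [set f | exists2 t, 0 <= t & f = fun x => p (x + t%:K *: a) - t * p a] f ->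
  - p (- x) <= f x.
Proof.
move=> sp [t t0 ->]; rewrite -(sublinearZ a sp t0).
by have := sp.1 (x + t%:K *: a) (- x); rewrite addrAC subrr add0r; lra.
Qed.

Lemma sublinear_directional_inf p a : sublinear p -> sublinear (directional_inf p a).
Proof.
move=> sp; apply: sublinear_pointwise_inf.
- by exists (fun x => p (x + 0%:K *: a) - 0 * p a), 0.
- by move=> x; exists (- p (- x)) => g; apply: directional_lb.
- move=> _ _ x y [s s0 ->] [t t0 ->].
  exists (fun x => p (x + (s + t)%:K *: a) - (s + t) * p a).
    by exists (s + t) => //; rewrite addr_ge0.
  by have := sp.1 (x + s%:K *: a) (y + t%:K *: a); rewrite of_realD scalerDl addrACA; lra.
- move=> _ r x [t t0 ->] r0.
  exists (fun x => p (x + (r * t)%:K *: a) - (r * t) * p a).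
    by exists (r * t) => //; rewrite mulr_ge0.
  rewrite of_realM -scalerA -scalerDr (sublinearZ _ sp r0); lra.
Qed.

Lemma directional_inf_le p a t x : sublinear p -> 0 <= t ->
  directional_inf p a x <= p (x + t%:K *: a) - t * p a.
Proof.
move=> sp t0; pose f x := p (x + t%:K *: a) - t * p a.
rewrite -/(f x); apply: pointwise_inf_le; last by exists t.
by exists (- p (- x)) => g; apply: directional_lb.
Qed.

Lemma directional_inf_le_id p a x : sublinear p -> directional_inf p a x <= p x.
Proof.
move=> sp; have := directional_inf_le a x sp (lexx 0).
by rewrite of_real0 scale0r addr0 mul0r subr0.
Qed.

Lemma directional_infN p a : sublinear p -> directional_inf p a (- a) <= - p a.
Proof.
move=> sp; have := directional_inf_le a (- a) sp ler01.
by rewrite of_real1 scale1r addNr mul1r sublinear0// sub0r.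
Qed.

(** Zorn's lemma: the lower bound of a chain is its pointwise infimum, finite
    because p x >= - p (- x) >= - p0 (- x) for each p in the chain. *)
Lemma minimal_sublinear p0 : sublinear p0 ->
  exists p, [/\ sublinear p, forall x, p x <= p0 x &
    forall q, sublinear q -> (forall x, q x <= p x) -> q = p].
Proof.
move=> sp0.
pose T := {p | sublinear p /\ forall x, p x <= p0 x}.
pose le (p q : T) : bool := `[< forall x, sval q x <= sval p x >].
have [||||[p [sp pp0]] pmin] := @Zorn T le.
- by move=> p; apply/asboolP.
- move=> p q r /asboolP pq /asboolP qr; apply/asboolP => x.
  exact: le_trans (qr x) (pq x).
- move=> [p p_le] [q q_le] /asboolP/= pq /asboolP/= qp; apply: eq_exist.
  by apply/funext => x; apply/eqP; rewrite eq_le qp pq.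
- move=> A Atot.
  have [->|/set0P[q0 Aq0]] := eqVneq A set0.
    by exists (exist _ p0 (conj sp0 (fun=> lexx _))).
  pose F : set (X -> R) := [set sval q | q in A].
  have Fb x : exists b, forall g, F g -> b <= g x.
    exists (- p0 (- x)) => _ [[q [sq qp0]] _ <-] /=.
    by apply: le_trans (sublinear_ge _ sq); rewrite lerN2.
  have sF : sublinear (pointwise_inf F).
    apply: sublinear_pointwise_inf => //.
    - by exists (sval q0), q0.
    - move=> _ _ x y [f Af <-] [g Ag <-].
      have [/asboolP gf|/asboolP fg] := Atot f g Af Ag.
        exists (sval g); first by exists g.
        by rewrite (le_trans ((svalP g).1.1 _ _))// lerD2r.
      exists (sval f); first by exists f.
      by rewrite (le_trans ((svalP f).1.1 _ _))// lerD2l.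
    - move=> _ r x [f Af <-] r0; exists (sval f); first by exists f.
      exact: (svalP f).1.2.
  have Fle (q : T) : A q -> forall x, pointwise_inf F x <= sval q x.
    by move=> Aq x; apply: pointwise_inf_le => //; exists q.
  have Fp0 x : pointwise_inf F x <= p0 x.
    exact: le_trans (Fle _ Aq0 x) ((svalP q0).2 x).
  exists (exist _ (pointwise_inf F) (conj sF Fp0)) => q Aq; apply/asboolP => x /=.
  exact: Fle.
exists p; split => // q sq qp.
have qp0 x : q x <= p0 x by apply: le_trans (qp x) (pp0 x).
apply: (congr1 sval (pmin (exist _ q (conj sq qp0)) _)).
exact/asboolP.
Qed.

(** Minimality forces [directional_inf p x] to be p itself, and at - x the
    former is at most - p x. An odd sublinear functional is linear. *)
Lemma minimal_sublinear_odd p : sublinear p ->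
  (forall q, sublinear q -> (forall x, q x <= p x) -> q = p) ->
  forall x, p (- x) = - p x.
Proof.
move=> sp pmin x.
have := directional_infN x sp; rewrite (pmin (directional_inf p x)); first by
  have := sublinear_ge x sp; lra.
  exact: sublinear_directional_inf.
by move=> y; apply: directional_inf_le_id.
Qed.

Lemma sublinear_rnorm : sublinear (@rnorm R k X).
Proof. by split=> [x y|r x r0]; rewrite ?rnormD// rnormZ ger0_norm. Qed.

(** A minimal functional u below [directional_inf rnorm x0] satisfies
    u (- x0) <= - ||x0||, that is, u x0 >= ||x0||. *)
Lemma real_norming x0 : exists u : X -> R,
  [/\ forall x y, u (x + y) = u x + u y, forall r x, u (r%:K *: x) = r * u x,
      forall x, u x <= rnorm x & u x0 = rnorm x0].
Proof.
have sn := sublinear_rnorm.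
have [u [su un umin]] := minimal_sublinear (sublinear_directional_inf x0 sn).
have uN := minimal_sublinear_odd su umin.
have u_le x : u x <= rnorm x by apply: le_trans (un x) (directional_inf_le_id _ _ sn).
exists u; split => //.
- move=> x y; apply/eqP; rewrite eq_le su.1 /=.
  by have := su.1 (- x) (- y); rewrite -opprD !uN; lra.
- move=> r x; have [r0|r0] := leP 0 r; first exact: sublinearZ.
  rewrite -[r]opprK of_realN scaleNr uN sublinearZ ?oppr_ge0 ?ltW//; ring.
apply/eqP; rewrite eq_le u_le /=.
by have := le_trans (un (- x0)) (directional_infN x0 sn); rewrite uN; lra.
Qed.

End sublinear.

Section norming.
Variable R : realType.

(** The complex functional with real part u is x |-> u x - i u (i x). *)
Lemma complex_linear_of_re (X : normedModType R[i]) (u : X -> R) :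
  (forall x y, u (x + y) = u x + u y) ->
  (forall r x, u (real_complex R r *: x) = r * u x) ->
  exists f : {linear X -> R[i]^o}, forall x, complex.Re (f x : R[i]) = u x.
Proof.
move=> uD uZ.
pose f x : R[i]^o := Complex (u x) (- u ('i%C *: x)).
have flin : linear f.
  move=> [a b] x y; apply/eqP.
  have ab z : (Complex a b) *: z = real_complex R a *: z + real_complex R b *: ('i%C *: z).
    rewrite scalerA -scalerDl; congr (_ *: _); apply/eqP.
    rewrite eq_complex /=; apply/andP; split; apply/eqP; ring.
  have ii z : 'i%C *: ('i%C *: z) = - z.
    rewrite scalerA -scaleN1r; congr (_ *: _); apply/eqP.
    by rewrite eq_complex /=; apply/andP; split; apply/eqP; ring.
  rewrite /f eq_complex /= ab !scalerDr !uD.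
  rewrite !scalerA !(mulrC 'i%C) -!scalerA !uZ ii.
  have uN z : u (- z) = - u z.
    by have := uZ (-1) z; rewrite rmorphN rmorph1 scaleN1r mulN1r.
  rewrite uN; apply/andP; split; apply/eqP; ring.
pose F : {linear X -> R[i]^o} := HB.pack f (GRing.isLinear.Build _ _ _ _ f flin).
by exists F.
Qed.

Lemma norming_functional (k : scalar_kind) (X : normedModType (scalars R k)) (x0 : X) :
  exists2 f : {linear X -> (scalars R k)^o},
    dual_ball f & re_scalar (f x0 : scalars R k) = rnorm x0.
Proof.
have [u [uD uZ un ux0]] := real_norming x0.
suff [f fu] : exists f : {linear X -> (scalars R k)^o},
    forall x, re_scalar (f x : scalars R k) = u x.
  by exists f; [apply/dual_ballP => x; rewrite fu|rewrite fu].
case: k X x0 u uD uZ {un ux0} => X x0 u uD uZ; last exact: complex_linear_of_re.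
have ulin : linear (u : X -> R^o) by move=> r x y; rewrite uD uZ.
pose F : {linear X -> R^o} := HB.pack u (GRing.isLinear.Build _ _ _ _ u ulin).
by exists F.
Qed.

End norming.

(** * Delta-points of an absolute sum *)

Section absnorm.
Variables (R : realType) (N : abs_norm R).
Implicit Types a b s t r : R.

Lemma abs_norm_a0 a : N a 0 = `|a|.
Proof. by have := abs_normZ N a 1 0; rewrite mulr1 mulr0 abs_norm10 mulr1. Qed.

Lemma abs_norm_0b b : N 0 b = `|b|.
Proof. by have := abs_normZ N b 0 1; rewrite mulr1 mulr0 abs_norm01 mulr1. Qed.

Lemma abs_norm_ge_l a b : 0 <= a -> 0 <= b -> a <= N a b.
Proof.
move=> a0 b0; have := @abs_norm_ler R N a 0 b.
by rewrite lexx b0 abs_norm_a0 ger0_norm//; apply.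
Qed.

Lemma abs_norm_ge_r a b : 0 <= a -> 0 <= b -> b <= N a b.
Proof.
move=> a0 b0; have := @abs_norm_lel R N 0 b a.
by rewrite lexx a0 abs_norm_0b ger0_norm//; apply.
Qed.

(** The point (s - d, r) divides the segment from (0, r) to (s, r), and
    N 0 r = r. *)
Lemma abs_norm_shrink_l s r d : 0 <= d <= s -> 0 <= r ->
  s * N (s - d) r <= (s - d) * N s r + d * r.
Proof.
move=> /andP[d0 ds] r0.
have sd0 : 0 <= s - d by lra.
have := abs_normD N ((s - d) * s) ((s - d) * r) (d * 0) (d * r).
rewrite !abs_normZ abs_norm_0b (ger0_norm sd0) (ger0_norm d0) (ger0_norm r0).
apply: le_trans; rewrite -{1}(@ger0_norm _ s) -?abs_normZ; last lra.
by rewrite le_eqVlt; apply/orP; left; apply/eqP; congr (N _ _); ring.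
Qed.

(** Since the average of (a, b) and (a', b') has second coordinate at most
    (1 + b) / 2, which is less than 1 when b < 1, lowering its first coordinate
    must lower N by a definite amount. *)
Lemma abs_norm_gap a b a' b' s t d : 0 <= a -> 0 <= a' -> 0 <= b -> 0 <= b' ->
  N a b <= 1 -> N a' b' <= 1 -> 0 <= d ->
  0 <= s <= a + a' - d -> 0 <= t <= b + b' ->
  N s t <= 2 - d * (1 - b) / 2.
Proof.
move=> a0 a'0 b0 b'0 Nab Na'b' d0 sle tle.
apply: le_trans (abs_norm_le N sle tle) _.
have a1 := le_trans (abs_norm_ge_l a0 b0) Nab.
have b1 := le_trans (abs_norm_ge_r a0 b0) Nab.
have a'1 := le_trans (abs_norm_ge_l a'0 b'0) Na'b'.
have b'1 := le_trans (abs_norm_ge_r a'0 b'0) Na'b'.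
have N2 : N (a + a') (b + b') <= 2.
  by apply: le_trans (abs_normD _ _ _ _ _) _; lra.
have /andP[s0 sd] := sle.
have [dz|dn0] := eqVneq d 0; first by rewrite dz subr0 !mul0r subr0.
have dp : 0 < d by rewrite lt_neqAle eq_sym dn0.
clear dn0 sle tle Nab Na'b'.
have := @abs_norm_shrink_l (a + a') (b + b') d.
move=> /(_ ltac:(apply/andP; split; lra) ltac:(lra)).
set n := N _ _ => h.
have {h N2} h : (a + a') * n <= (a + a' - d) * 2 + d * (b + b').
  apply: le_trans h _; rewrite lerD2r ler_wpM2l//; lra.
have {}h : d * (1 - b) <= (a + a') * (2 - n).
  by have := ler_wpM2l d0 b'1; lra.
have db : 0 <= d * (1 - b) by rewrite mulr_ge0//; lra.
have n2 : 0 <= 2 - n.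
  by rewrite -(@pmulr_rge0 _ (a + a')) ?(le_trans db)//; lra.
have : (a + a') * (2 - n) <= 2 * (2 - n) by rewrite ler_wpM2r//; lra.
lra.
Qed.

(** In the application x is Re g(u, 0) / c, h is Re g(0, v), f is Re f u and nu
    is ||u||. The last hypothesis, with t = c sg / 4, says that the tilted
    functional is large at (u, v). As c x + h <= 1, the tilt f - (1 - al) x must exceed
    sg / 2, which keeps u away from 0. If al >= 1 this also gives
    f > (1 - al) nu, as x <= nu. If al < 1, the tilt is at most 2, so c x + h
    is within 2 t of 1 and x within sg / 2 of nu; replacing x by nu in
    f > (1 - al) x + sg / 2 then costs less than sg / 2. *)
Lemma slice_estimate (al c sg f x nu h : R) : 0 < al -> 0 < c -> 0 < sg ->
  - nu <= x <= nu -> f <= nu -> 0 <= nu <= 1 -> c * nu + h <= 1 ->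
  1 + c * sg / 4 * sg / 2 < c * x + h + c * sg / 4 * (f - (1 - al) * x) ->
  (1 - al) * nu < f /\ sg / (2 * (2 + al)) <= nu.
Proof.
move=> al0 c0 sg0 /andP[x_ge x_le] fnu /andP[nu0 nu1] ch.
set t := c * sg / 4 => F1.
have t0 : 0 < t by rewrite /t divr_gt0// mulr_gt0.
have cx : c * x <= c * nu by rewrite ler_pM2l.
have A : sg / 2 < f - (1 - al) * x by rewrite -(ltr_pM2l t0); clearbody t; lra.
have B : al * x <= al * nu by rewrite ler_pM2l.
split; last by rewrite ler_pdivrMr; clearbody t; lra.
have [al1|al1] := leP 1 al.
  have : 0 <= (al - 1) * (nu - x) by rewrite mulr_ge0 ?subr_ge0.
  by clear F1 cx ch t0; clearbody t; lra.
have al1' : 0 <= 1 - al by rewrite subr_ge0 ltW.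
have C2 : f - (1 - al) * x <= 2.
  have := ler_wpM2l al1' x_ge.
  have := ler_wpM2l al1' nu1.
  by clear F1 cx ch t0; clearbody t; lra.
have {}C2 := ler_wpM2l (ltW t0) C2.
have : c * (nu - x) < c * (sg / 2).
  have -> : c * (sg / 2) = t * 2 by rewrite /t; field.
  have : 0 < t * sg by rewrite mulr_gt0.
  clearbody t; lra.
rewrite ltr_pM2l// => /ltW/(ler_wpM2l al1').
have : 0 < al * sg by rewrite mulr_gt0.
clear F1 C2 cx ch t0; clearbody t; lra.
Qed.

(** If N 1 1 <= 1, then N is at most the max norm by homogeneity and
    monotonicity, while every absolute normalised norm is at least that. *)
Lemma abs_norm11_gt1 : ~ (forall a b : R, N a b = Num.max `|a| `|b|) -> 1 < N 1 1.
Proof.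
move=> Nmax; rewrite ltNge; apply/negP => N11; apply: Nmax => a b.
rewrite abs_norm_abs; set s := `|a|; set t := `|b|.
have s0 : 0 <= s := normr_ge0 a; have t0 : 0 <= t := normr_ge0 b.
apply/eqP; rewrite eq_le ge_max abs_norm_ge_l//= abs_norm_ge_r// andbT.
set m := Num.max s t.
have sm : s <= m by rewrite le_max lexx.
have tm : t <= m by rewrite le_max lexx orbT.
have m0 : 0 <= m by apply: le_trans sm.
have := @abs_norm_le R N s t m m; rewrite s0 t0 sm tm => /(_ isT isT) /le_trans; apply.
have := abs_normZ N m 1 1; rewrite mulr1 (ger0_norm m0) => ->.
by rewrite ler_piMr.
Qed.

End absnorm.

Section abs_sum.
Variables (R : realType) (k : scalar_kind) (N : abs_norm R).
Variables (X Y : normedModType (scalars R k)).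
Local Notation K := (scalars R k).
Local Notation Z := (abs_sum N X Y).
Local Notation "r %:K" := (of_real k r) (at level 1, left associativity, format "r %:K").
Local Notation Re z := (re_scalar (z : K)).

Lemma pair_combination (g : {linear Z -> K^o}) (f : {linear X -> K^o}) (q s t : R) :
  exists F : {linear Z -> K^o}, forall p : Z,
    Re (F p) = q * (Re (g p) + s * Re (f p.1) - t * Re (g (p.1, 0))).
Proof.
pose F (p : Z) : K := q%:K * (g p + s%:K * f p.1 - t%:K * g ((p.1, 0) : Z)).
have Flin : linear (F : Z -> K^o).
  move=> r u v.
  have e : ((r *: u + v).1, 0) = r *: ((u.1, 0) : Z) + ((v.1, 0) : Z) :> Z.
    by congr (_, _); rewrite /= scaler0 addr0.
  have gP (w w' : Z) : g (r *: w + w') = (r * g w + g w' : K) by rewrite linearP.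
  have fP : f (r *: u + v).1 = (r * f u.1 + f v.1 : K) by rewrite /= linearP.
  rewrite /F e fP !gP; rewrite -[_ *: _]/(_ * _ : K); ring.
pose F' : {linear Z -> K^o} :=
  HB.pack (F : Z -> K^o) (GRing.isLinear.Build _ _ _ _ (F : Z -> K^o) Flin).
exists F' => p; rewrite /= /F.
by rewrite !re_scalarZ !re_scalarD re_scalarN !re_scalarZ.
Qed.

Section key.
Variable p : Z.
Hypotheses (p1 : rnorm p = 1) (p2lt1 : rnorm p.2 < 1).
Let x := p.1.
Let y := p.2.
Let a := rnorm x.
Let b := rnorm y.

Lemma rnorm_fst_gt0 : 0 < a.
Proof.
rewrite lt_neqAle rnorm_ge0 andbT eq_sym; apply/eqP => a0.
move: p1; rewrite rnorm_abs_sum -/x -/y -/a a0 abs_norm_0b ger0_norm ?rnorm_ge0//.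
by move=> yy; move: p2lt1; rewrite yy ltxx.
Qed.

(** The last two bounds say that the restriction of g to X has norm c, and
    that c ||u|| + Re g(0, v) is still controlled by N: both follow by testing
    g against (a u, ||u|| y) and (||u|| x, a v), that is, by exchanging the
    directions of u and x. *)
Lemma norming_abs_sum : exists (g : {linear Z -> K^o}) (c : R),
  [/\ dual_ball g, 0 < c & [/\ Re (g p) = 1, Re (g (x, 0)) = c * a,
    (forall u : X, Re (g (u, 0)) <= c * rnorm u) &
    forall (u : X) (v : Y), c * rnorm u + Re (g (0, v)) <= N (rnorm u) (rnorm v)]].
Proof.
have [g gd gp] := norming_functional p.
have gle (u : X) (v : Y) : Re (g (u, 0)) + Re (g (0, v)) <= N (rnorm u) (rnorm v).
  have -> : N (rnorm u) (rnorm v) = rnorm ((u, v) : Z) by rewrite rnorm_abs_sum.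
  rewrite -re_linearD.
  have -> : (u, 0) + (0, v) = (u, v) :> Z by congr (_, _); rewrite /= ?addr0 ?add0r.
  by move/dual_ballP: gd; apply.
have gZ1 r u : Re (g (r%:K *: u, 0)) = r * Re (g (u, 0)).
  by rewrite -re_linearZ; congr (Re (g (_, _))); rewrite /= scaler0.
have gZ2 r v : Re (g (0, r%:K *: v)) = r * Re (g (0, v)).
  by rewrite -re_linearZ; congr (Re (g (_, _))); rewrite /= scaler0.
have a0 := rnorm_fst_gt0.
have gxy : Re (g (x, 0)) + Re (g (0, y)) = 1.
  rewrite -re_linearD -p1 -gp; congr (Re (g _)).
  by rewrite /x /y; case: (p) => u v; congr (_, _); rewrite /= ?addr0 ?add0r.
have Nab : N a b = 1 by rewrite -p1 rnorm_abs_sum.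
have yb : Re (g (0, y)) <= b.
  have := gle 0 y; rewrite rnorm0 abs_norm_0b ger0_norm ?rnorm_ge0//.
  by have := gZ1 0 0; rewrite scaler0 mul0r => ->; rewrite add0r.
exists g, (Re (g (x, 0)) / a).
have ca : Re (g (x, 0)) / a * a = Re (g (x, 0)) by rewrite mulfVK// gt_eqF.
split => //; first by rewrite divr_gt0//; have b1 : b < 1 := p2lt1; lra.
split; rewrite ?gp//.
- move=> u; rewrite -(ler_pM2l a0) mulrA (mulrC a (_ / a)) ca.
  have := gle (a%:K *: u) ((rnorm u)%:K *: y).
  rewrite gZ1 gZ2 !rnormZ !ger0_norm ?rnorm_ge0 ?(ltW a0)//.
  rewrite -/b (mulrC a (rnorm u)) abs_normZ Nab ger0_norm ?rnorm_ge0//.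
  have -> : Re (g (x, 0)) = 1 - Re (g (0, y)) by lra.
  lra.
- move=> u v; rewrite -(ler_pM2l a0) mulrDr mulrA (mulrC a (_ / a)) ca.
  have := gle ((rnorm u)%:K *: x) (a%:K *: v).
  rewrite gZ1 gZ2 !rnormZ !ger0_norm ?rnorm_ge0 ?(ltW a0)//.
  rewrite -/a (mulrC (rnorm u) a) abs_normZ ger0_norm; last exact: ltW.
  by rewrite (mulrC (rnorm u)).
Qed.

End key.

(** Split off the common part m (x0 - w) and use the triangle inequality on
    the rest. *)
Lemma rnorm_gap (x0 w : X) (a c m e : R) : rnorm x0 = 1 -> rnorm w = 1 ->
  0 <= m -> m <= a -> m <= c -> rnorm (x0 - w) <= 2 - e ->
  rnorm (a%:K *: x0 - c%:K *: w) <= a + c - m * e.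
Proof.
move=> x01 w1 m0 ma mc d.
have -> : a%:K *: x0 - c%:K *: w =
    m%:K *: (x0 - w) + ((a - m)%:K *: x0 + (m - c)%:K *: w).
  rewrite scalerBr !of_realD !of_realN !scalerBl addrACA subrKC.
  by congr (_ + _); rewrite addKr.
apply: le_trans (rnormD _ _) _; rewrite rnormZ (ger0_norm m0).
have := rnormD ((a - m)%:K *: x0) ((m - c)%:K *: w).
rewrite !rnormZ x01 w1 (distrC m c) !ger0_norm ?subr_ge0//.
by have := ler_wpM2l m0 d; lra.
Qed.

(** Tilting a norming functional of p yields a slice around p from which every
    almost diametral point projects, after normalisation, into the given slice
    of the ball of X. *)
Lemma Delta_point_fst (p : Z) : Delta_point p -> rnorm p.2 < 1 ->
  Delta_point ((rnorm p.1)^-1%:K *: p.1).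
Proof.
move=> [p1 pD] p2.
have [g [c [gd c0 [gp gx gle1 gle2]]]] := norming_abs_sum p1 p2.
have a0 := rnorm_fst_gt0 p1 p2.
move: p p1 pD p2 gp gx gle1 gle2 a0 => [x y] /= p1 pD b1 gp gx gle1 gle2 a0.
set a := rnorm x in gx a0 *; set b := rnorm y in b1.
have Nab : N a b = 1 by rewrite -[LHS](rnorm_abs_sum ((x, y) : Z)).
have b0 : 0 <= b := rnorm_ge0 y.
set x0 := a^-1%:K *: x.
have x01 : rnorm x0 = 1.
  by rewrite rnormZ ger0_norm ?invr_ge0 ?ltW// mulVf// gt_eqF.
split=> // f al fd al0 [_ fx0] eps eps0.
have fle u : Re (f u) <= rnorm u by move/dual_ballP: fd; apply.
pose sg := Re (f x) - (1 - al) * a.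
have sg0 : 0 < sg.
  by move: fx0; rewrite re_linearZ mulrC ltr_pdivlMr// subr_gt0.
have sgal : sg <= al.
  have a1 : a <= 1 by rewrite -Nab; apply: abs_norm_ge_l => //; apply: ltW.
  have : al * a <= al by rewrite ler_piMr// ltW.
  have := fle x; rewrite -/a /sg; lra.
(* The tilt is t (f - (1 - al) g1 / c), where g1 is the restriction of g to X
   and t (1 - al) / c = tau. The value of t is small enough both for
   slice_estimate and for 1 - tau >= 0, which the norm bound uses. *)
pose t := c * sg / 4; pose tau := sg * (1 - al) / 4.
have t0 : 0 < t by rewrite divr_gt0// mulr_gt0.
have tauc : tau * c = t * (1 - al) by rewrite /tau /t; field.
have tau1 : 0 <= 1 - tau.
  by rewrite /tau; clear -sg0 sgal al0; nra.
(* D bounds the norm of the tilted functional, whose value at (x, y) is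
   1 + t sg; the slice is cut at 1 + t sg / 2. *)
pose D := 1 + t * al.
have D0 : 0 < D by rewrite /D addr_gt0// mulr_gt0.
have [F FE] := pair_combination g f D^-1 t tau.
have FED q : D * Re (F q) = Re (g q) + t * Re (f q.1) - tau * Re (g (q.1, 0)).
  by rewrite FE mulrA divff ?mul1r// gt_eqF.
have gE (u : X) (v : Y) : Re (g (u, v)) = Re (g (u, 0)) + Re (g (0, v)).
  by rewrite -re_linearD; congr (Re (g (_, _))); rewrite /= ?addr0 ?add0r.
have Fd : dual_ball F.
  apply/dual_ballP => -[u v]; rewrite -(ler_pM2l D0) FED /= gE rnorm_abs_sum /=.
  have h1 := ler_wpM2l tau1 (gle1 u).
  have h2 := ler_wpM2l (ltW t0) (fle u).
  have h3 := gle2 u v.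
  have h4 := ler_wpM2l (ltW (mulr_gt0 t0 al0))
    (abs_norm_ge_l N (rnorm_ge0 u) (rnorm_ge0 v)).
  have h5 : tau * (c * rnorm u) = t * (1 - al) * rnorm u by rewrite mulrA tauc.
  by rewrite /D; clear -h1 h2 h3 h4 h5; lra.
pose bt := 1 - (1 + t * sg / 2) / D.
have slice_bt q : unit_ball q -> slice F bt q <-> 1 + t * sg / 2 < D * Re (F q).
  move=> q1; rewrite /slice /= /bt opprB addrC subrK ltr_pdivrMr// (mulrC _ D).
  by split=> [[]|].
have tsg0 : 0 < t * sg by rewrite mulr_gt0.
have bt0 : 0 < bt.
  rewrite subr_gt0 ltr_pdivrMr// mul1r ltrD2l.
  have : t * sg <= t * al by rewrite ler_wpM2l// ltW.
  by clear -tsg0; lra.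
have pS : slice F bt (x, y).
  apply/slice_bt; rewrite /unit_ball /= ?p1// FED /= gp gx mulrA tauc.
  have : t * sg = t * Re (f x) - t * (1 - al) * a by rewrite /sg; ring.
  by clear -tsg0; lra.
(* A lower bound of a and of ||u|| for every (u, v) in the slice; ep is chosen
   in terms of it. *)
pose m := Num.min a (sg / (2 * (2 + al))).
have m0 : 0 < m.
  by rewrite lt_min a0 divr_gt0// mulr_gt0// addr_gt0.
pose ep := m * eps * (1 - b) / 4.
have ep0 : 0 < ep by rewrite divr_gt0// !mulr_gt0// subr_gt0.
have [[u v] /[dup][[q1 _]]/slice_bt] := pD F bt Fd bt0 pS ep ep0.
move=> /(_ q1); rewrite FED /= gE => qF pq.
have {}q1 : N (rnorm u) (rnorm v) <= 1 by rewrite -[leLHS](rnorm_abs_sum ((u, v) : Z)).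
pose xs := Re (g (u, 0)) / c.
have xsE : Re (g (u, 0)) = c * xs by rewrite /xs mulrC mulfVK// gt_eqF.
have xs_nu : - rnorm u <= xs <= rnorm u.
  rewrite -(ler_pM2l c0 xs) -xsE gle1 andbT lerNl -(ler_pM2l c0) mulrN -xsE -re_linearN.
  by have := gle1 (- u); rewrite rnormN; congr (Re (g (_, _)) <= _); rewrite /= oppr0.
have nu01 : 0 <= rnorm u <= 1.
  by rewrite rnorm_ge0 (le_trans (abs_norm_ge_l N (rnorm_ge0 _) (rnorm_ge0 v)) q1).
have [|fu mu] := slice_estimate al0 c0 sg0 xs_nu (fle u) nu01 (le_trans (gle2 u v) q1).
  rewrite -/t; move: qF; rewrite xsE mulrA tauc.
  by clear; lra.
have {}mu : m <= rnorm u by rewrite (le_trans _ mu)// ge_min lexx orbT.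
have nup : 0 < rnorm u := lt_le_trans m0 mu.
pose w := (rnorm u)^-1%:K *: u.
have w1 : rnorm w = 1.
  by rewrite rnormZ ger0_norm ?invr_ge0 ?ltW// mulVf// gt_eqF.
exists w.
  split; first by rewrite /unit_ball /= w1.
  by rewrite re_linearZ mulrC ltr_pdivlMr.
rewrite leNgt; apply/negP => /ltW dlt.
have ma : m <= a by rewrite ge_min lexx.
have := rnorm_gap x01 w1 (ltW m0) ma mu dlt.
rewrite /x0 /w !scalerA -!of_realM !divff ?gt_eqF// of_real1 !scale1r => xu.
have yv : rnorm (y - v) <= b + rnorm v by rewrite (le_trans (rnormD _ _))// rnormN.
have : 2 - ep <= 2 - m * eps * (1 - b) / 2.
  apply: le_trans pq _; rewrite rnorm_abs_sum.
  apply: (abs_norm_gap (a := a) (a' := rnorm u) (b' := rnorm v)) => //.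
  - by rewrite ltW.
  - by rewrite rnorm_ge0.
  - by rewrite rnorm_ge0.
  - by rewrite Nab.
  - by rewrite mulr_ge0 ?ltW.
  - by rewrite rnorm_ge0.
  - by rewrite rnorm_ge0.
by move: ep0; rewrite /ep; clear; lra.
Qed.

End abs_sum.

(** * The convex hull of the Delta-points *)

Section hull.
Variables (R : realType) (k : scalar_kind) (X : normedModType (scalars R k)).
Local Notation K := (scalars R k).
Local Notation "r %:K" := (of_real k r) (at level 1, left associativity, format "r %:K").
Local Notation Re z := (re_scalar (z : K)).

(** The form in which closed convex hulls are used: a convex Lipschitz
    function is bounded on the hull by its bound on A. *)
Lemma closed_convex_hull_sublevel (A : set X) (phi : X -> R) (L s : R) : 0 <= L ->
  (forall x y, phi x <= phi y + L * rnorm (x - y)) ->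
  (forall x y r, 0 <= r <= 1 ->
    phi (r%:K *: x + (1 - r)%:K *: y) <= r * phi x + (1 - r) * phi y) ->
  (forall x, A x -> phi x <= s) -> forall x, closed_convex_hull A x -> phi x <= s.
Proof.
move=> L0 phiL phiC As; apply: closed_convex_hull_sub; last exact: As.
- apply/closed_rnormP => x xs; apply/ler_addgt0Pr => e e0.
  have L1 : 0 < L + 1 by lra.
  have [|y /= ys xy] := xs (e / (L + 1)); first by rewrite divr_gt0.
  apply: le_trans (phiL x y) _; rewrite lerD//.
  rewrite ltr_pdivlMr// in xy; apply: le_trans (ltW xy).
  by rewrite mulrC ler_wpM2l ?rnorm_ge0//; lra.
- apply/convex_set_realP => x y r /= xs ys /[dup] /andP[r0 r1] r01.
  apply: le_trans (phiC x y r r01) _.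
  have -> : s = r * s + (1 - r) * s by ring.
  by rewrite lerD// ler_wpM2l// subr_ge0.
Qed.

Lemma rnorm_convex (x y : X) r : 0 <= r <= 1 ->
  rnorm (r%:K *: x + (1 - r)%:K *: y) <= r * rnorm x + (1 - r) * rnorm y.
Proof.
move=> /andP[r0 r1]; apply: le_trans (rnormD _ _) _.
by rewrite !rnormZ !ger0_norm// subr_ge0.
Qed.

Lemma closed_convex_hull_unit_ball (A : set X) : A `<=` @unit_ball R k X ->
  closed_convex_hull A `<=` @unit_ball R k X.
Proof.
move=> A1; apply: (@closed_convex_hull_sublevel A (@rnorm R k X) 1) => // [x y|x y r].
  by rewrite mul1r -[x in leLHS](subrK y) addrC rnormD.
exact: rnorm_convex.
Qed.

Definition dist_to (C : set X) : X -> R :=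
  pointwise_inf [set (fun x => rnorm (x - c)) | c in C].

Lemma dist_to_le (C : set X) c x : C c -> dist_to C x <= rnorm (x - c).
Proof.
move=> Cc; apply: (@pointwise_inf_le _ _ _ _ (fun x => rnorm (x - c))); last by exists c.
by exists 0 => _ [d _ <-]; apply: rnorm_ge0.
Qed.

Lemma dist_to_lt (C : set X) x b : C !=set0 -> dist_to C x < b ->
  exists2 c, C c & rnorm (x - c) < b.
Proof.
move=> [c0 Cc0] xb; apply: contrapT => nc; move: xb; apply/negP; rewrite -leNgt.
apply: le_pointwise_inf; first by exists (fun x => rnorm (x - c0)), c0.
move=> _ [c Cc <-]; rewrite leNgt; apply/negP => xc.
by apply: nc; exists c.
Qed.

Lemma dist_to_lipschitz (C : set X) x y : C !=set0 ->
  dist_to C x <= dist_to C y + rnorm (x - y).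
Proof.
move=> C0; apply/ler_addgt0Pr => e e0.
have [|c Cc yc] := @dist_to_lt C y (dist_to C y + e) C0; first by rewrite ltrDl.
apply: le_trans (dist_to_le x Cc) _.
by have := rnormD (x - y) (y - c); rewrite addrA subrK; lra.
Qed.

Lemma dist_to_convex (C : set X) x y r : C !=set0 ->
  convex_set (C : set (convex_lmodType X)) -> 0 <= r <= 1 ->
  dist_to C (r%:K *: x + (1 - r)%:K *: y) <= r * dist_to C x + (1 - r) * dist_to C y.
Proof.
move=> C0 /convex_set_realP cC /[dup] r01 /andP[r0 r1]; apply/ler_addgt0Pr => e e0.
have [|c Cc xc] := @dist_to_lt C x (dist_to C x + e) C0; first by rewrite ltrDl.
have [|d Cd yd] := @dist_to_lt C y (dist_to C y + e) C0; first by rewrite ltrDl.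
apply: le_trans (dist_to_le _ (cC c d r Cc Cd r01)) _.
rewrite opprD addrACA -!scalerBr; apply: le_trans (rnorm_convex _ _ r01) _.
have r1' : 0 <= 1 - r by rewrite subr_ge0.
by have := ler_wpM2l r0 (ltW xc); have := ler_wpM2l r1' (ltW yd); lra.
Qed.

Lemma convex_DLD2P_ball : convex_DLD2P X <->
  @unit_ball R k X `<=` closed_convex_hull (@Delta_point R k X).
Proof.
split=> [->//|BC]; apply/seteqP; split=> //.
by apply: closed_convex_hull_unit_ball => x [x1 _]; rewrite /unit_ball /= x1.
Qed.

(** Every point of the ball lies on a segment from u to - u with u in the
    sphere. *)
Lemma unit_ball_sub_convex (C : set X) : (exists x : X, x <> 0) ->
  convex_set (C : set (convex_lmodType X)) ->
  @unit_sphere R k X `<=` C -> @unit_ball R k X `<=` C.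
Proof.
move=> [z z0] /convex_set_realP cC SC x x1.
have zn : rnorm z != 0 by apply/eqP => /rnorm_eq0.
have sphereV (u : X) : rnorm u != 0 -> unit_sphere ((rnorm u)^-1%:K *: u).
  move=> un; rewrite /unit_sphere /= rnormZ ger0_norm ?mulVf//.
  by rewrite invr_ge0 rnorm_ge0.
have [u u1 xu] : exists2 u, unit_sphere u & x = (rnorm x)%:K *: u.
  have [x0|xn] := eqVneq (rnorm x) 0.
    exists ((rnorm z)^-1%:K *: z); first exact: sphereV.
    by rewrite x0 of_real0 scale0r (rnorm_eq0 x0).
  exists ((rnorm x)^-1%:K *: x); first exact: sphereV.
  by rewrite scalerA -of_realM divff// of_real1 scale1r.
pose r := (1 + rnorm x) / 2.
have -> : x = r%:K *: u + (1 - r)%:K *: (- u).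
  rewrite scalerN -scalerBl -of_realN -of_realD [LHS]xu; congr (_%:K *: _).
  by rewrite /r; field.
have x0 := rnorm_ge0 x; have {}x1 : rnorm x <= 1 := x1.
apply: cC; rewrite /r; last by apply/andP; split; lra.
  exact: SC.
by apply: SC; rewrite /unit_sphere /= rnormN.
Qed.

End hull.

Section first_factor.
Variables (R : realType) (k : scalar_kind) (N : abs_norm R).
Variables (X Y : normedModType (scalars R k)).
Local Notation K := (scalars R k).
Local Notation Z := (abs_sum N X Y).
Local Notation "r %:K" := (of_real k r) (at level 1, left associativity, format "r %:K").
Local Notation Re z := (re_scalar (z : K)).

(** If ||p.2|| = 1, then N 1 1 <= N ||p.1|| 1 + N (1 - ||p.1||) 0
    = 2 - ||p.1||. *)
Lemma snd_lt1 (p : Z) : rnorm p = 1 -> 2 - N 1 1 < rnorm p.1 -> rnorm p.2 < 1.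
Proof.
rewrite rnorm_abs_sum => p1 p1N.
have p11 : rnorm p.1 <= 1 by rewrite -p1; apply: abs_norm_ge_l; apply: rnorm_ge0.
have p21 : rnorm p.2 <= 1 by rewrite -p1; apply: abs_norm_ge_r; apply: rnorm_ge0.
rewrite lt_neqAle p21 andbT; apply/eqP => p2; rewrite p2 in p1.
have := abs_normD N (rnorm p.1) 1 (1 - rnorm p.1) 0.
by rewrite p1 abs_norm_a0 ger0_norm ?subr_ge0// addr0 subrKC; lra.
Qed.

Lemma rnorm_fst_le (p : Z) : rnorm p.1 <= rnorm p.
Proof. by rewrite rnorm_abs_sum; apply: abs_norm_ge_l; apply: rnorm_ge0. Qed.

(** Compare a point x of the sphere with C through a convex function on the
    sum that is large wherever Re f is close to 1, f norming x: there the
    Delta-points of the sum are close to C, and elsewhere the term in Re f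
    absorbs the distance to C, which is at most 2. *)
Lemma convex_DLD2P_fst : (exists x : X, x <> 0) ->
  ~ (forall a b : R, N a b = Num.max `|a| `|b|) ->
  convex_DLD2P Z -> convex_DLD2P X.
Proof.
move=> X0 /abs_norm11_gt1 N11 /convex_DLD2P_ball ZD; apply/convex_DLD2P_ball.
set C := closed_convex_hull _.
have C_convex : convex_set (C : set (convex_lmodType X)).
  exact: convex_closed_convex_hull.
apply: unit_ball_sub_convex => // x x1.
have [f fd fx] := norming_functional x; rewrite x1 in fx.
have fle u : Re (f u) <= rnorm u by move/dual_ballP: fd; apply.
have xZ : closed_convex_hull (@Delta_point R k Z) (x, 0).
  by apply: ZD; rewrite /unit_ball /= rnorm_abs_sum /= x1 rnorm0 abs_norm10.
have f_lip (p q : Z) : Re (f p.1) <= Re (f q.1) + rnorm (p - q).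
  rewrite -lerBlDl -re_linearN -re_linearD; apply: le_trans (fle _) _.
  exact: rnorm_fst_le (p - q).
have f_conv (p q : Z) r :
    Re (f (r%:K *: p + (1 - r)%:K *: q).1) = r * Re (f p.1) + (1 - r) * Re (f q.1).
  by rewrite /= re_linearD !re_linearZ.
have sliceC d (p : Z) : d <= N 1 1 - 1 -> Delta_point p -> 1 - d < Re (f p.1) ->
    exists2 c, C c & rnorm (p.1 - c) <= d.
  move=> dN pD fp.
  have p1d : 1 - d < rnorm p.1 := lt_le_trans fp (fle _).
  have p2 : rnorm p.2 < 1 by apply: snd_lt1; [exact: pD.1|lra].
  have p10 := rnorm_fst_gt0 pD.1 p2.
  have p11 : rnorm p.1 <= 1 by rewrite (le_trans (rnorm_fst_le p))// (pD.1 : rnorm p = 1).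
  exists ((rnorm p.1)^-1%:K *: p.1).
    by apply: sub_closed_convex_hull; apply: Delta_point_fst.
  have -> : p.1 - (rnorm p.1)^-1%:K *: p.1 = (1 - (rnorm p.1)^-1)%:K *: p.1.
    by rewrite of_realD of_realN of_real1 scalerBl scale1r.
  rewrite rnormZ -[X in _ * X](ger0_norm (ltW p10)) -normrM mulrBl mul1r.
  by rewrite mulVf ?gt_eqF// distrC ger0_norm; lra.
(* Were C empty, all Delta-points of the sum, hence their hull, would lie in
   the half-space Re f <= 1 - d, but (x, 0) does not. *)
have C0 : C !=set0.
  pose d := N 1 1 - 1.
  apply: contrapT => C0; suff : Re (f (x, 0 : Y).1) <= 1 - d by rewrite /= fx /d; lra.
  apply: (@closed_convex_hull_sublevel _ _ _ (@Delta_point R k Z)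
    (fun p => Re (f p.1)) 1) => //.
  - by move=> p q; rewrite mul1r.
  - by move=> p q r _; rewrite f_conv.
  - move=> p pD; rewrite leNgt; apply/negP => fp; apply: C0.
    by have [c Cc _] := sliceC d p (lexx _) pD fp; exists c.
have C1 c : C c -> rnorm c <= 1.
  by apply: closed_convex_hull_unit_ball => u [u1 _]; rewrite /unit_ball /= u1.
have xd d : 0 < d -> d <= N 1 1 - 1 -> dist_to C x <= d.
  move=> d0 dN; pose M := 2 / d.
  have M0 : 0 < M by rewrite divr_gt0.
  suff : dist_to C (x, 0 : Y).1 + M * Re (f (x, 0 : Y).1) <= d + M by rewrite /= fx; lra.
  apply: (@closed_convex_hull_sublevel _ _ _ (@Delta_point R k Z)
    (fun p => dist_to C p.1 + M * Re (f p.1)) (1 + M)) => //.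
  - by rewrite addr_ge0// ltW.
  - move=> p q; have := dist_to_lipschitz p.1 q.1 C0.
    have := rnorm_fst_le (p - q); have := ler_wpM2l (ltW M0) (f_lip p q); rewrite /=.
    lra.
  - move=> p q r r01; rewrite f_conv.
    have := dist_to_convex p.1 q.1 C0 C_convex r01; rewrite /=; lra.
  - move=> p pD.
    have p11 : rnorm p.1 <= 1 by rewrite (le_trans (rnorm_fst_le p))// (pD.1 : rnorm p = 1).
    have [fp|fp] := ltP (1 - d) (Re (f p.1)).
      have [c Cc pc] := sliceC d p dN pD fp.
      apply: lerD; first exact: le_trans (dist_to_le _ Cc) pc.
      by rewrite ler_piMr ?(ltW M0)// (le_trans (fle _)).
    have [c Cc] := C0.
    have d2 : dist_to C p.1 <= 2.
      apply: le_trans (dist_to_le _ Cc) (le_trans (rnormD _ _) _).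
      by rewrite rnormN; have := C1 _ Cc; lra.
    have := ler_wpM2l (ltW M0) fp.
    have -> : M * (1 - d) = M - 2 by rewrite /M; field; rewrite gt_eqF.
    lra.
have C_closed : closed C by apply: closed_closed_convex_hull.
move/closed_rnormP: C_closed; apply => e e0.
apply: dist_to_lt => //.
pose d := Num.min (e / 2) (N 1 1 - 1).
have d0 : 0 < d by rewrite lt_min divr_gt0// subr_gt0.
apply: le_lt_trans (xd d d0 _) _; first by rewrite ge_min lexx orbT.
by rewrite gt_min; apply/orP; left; lra.
Qed.

End first_factor.

Section isometry.
Variables (R : realType) (k : scalar_kind) (V W : normedModType (scalars R k)).
Local Notation K := (scalars R k).
Variable T : {linear V -> W}.
Hypotheses (T_iso : forall z, rnorm (T z) = rnorm z) (T_surj : forall w, exists z, T z = w).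

Lemma Delta_point_isometry z : Delta_point z -> Delta_point (T z).
Proof.
move=> [z1 zD]; split; first by rewrite /unit_sphere /= T_iso.
move=> f al fd al0 [_ fz] eps eps0.
pose fT : {linear V -> K^o} := (f : {linear W -> K^o}) \o T.
have fTd : dual_ball fT.
  by apply/dual_ballP => u; rewrite -T_iso; move/dual_ballP: fd; apply.
have zS : slice fT al z by split=> //; rewrite /unit_ball /= z1.
have [y [y1 fy] zy] := zD fT al fTd al0 zS eps eps0.
exists (T y); last by rewrite -linearB T_iso.
by split=> //; rewrite /unit_ball /= T_iso.
Qed.

Lemma convex_DLD2P_isometry : convex_DLD2P V -> convex_DLD2P W.
Proof.
move=> /convex_DLD2P_ball VD; apply/convex_DLD2P_ball => w w1.
have [z zw] := T_surj w.
suff hullT : closed_convex_hull (@Delta_point R k V) `<=`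
    T @^-1` closed_convex_hull (@Delta_point R k W).
  have z1 : unit_ball z by rewrite /unit_ball /= -T_iso zw.
  by rewrite -zw; exact: hullT (VD z z1).
apply: closed_convex_hull_sub.
- apply/closed_rnormP => x xD.
  have CW : closed (closed_convex_hull (@Delta_point R k W)).
    exact: closed_closed_convex_hull.
  move/closed_rnormP: CW; apply=> e /xD[y Dy xy]; exists (T y) => //.
  by rewrite -linearB T_iso.
- apply/convex_set_realP => x y r Dx Dy r01; rewrite /preimage /= linearD !linearZ.
  have CW : convex_set (closed_convex_hull (@Delta_point R k W) : set (convex_lmodType W)).
    exact: convex_closed_convex_hull.
  by move/convex_set_realP: CW; apply.
- by move=> y yD; apply: sub_closed_convex_hull; exact: Delta_point_isometry.
Qed.

End isometry.

Section swap.
Variable R : realType.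

Definition abs_norm_swap (N : abs_norm R) : abs_norm R :=
  @AbsNorm R (fun a b => N b a) (fun a b c d => abs_normD N b a d c)
    (fun t a b => abs_normZ N t b a)
    (fun a b N0 => let: conj b0 a0 := abs_norm_eq0 N0 in conj a0 b0)
    (fun a b => abs_norm_abs N b a) (abs_norm01 N) (abs_norm10 N).

Variables (k : scalar_kind) (N : abs_norm R) (X Y : normedModType (scalars R k)).

Lemma convex_DLD2P_swap :
  convex_DLD2P (abs_sum N X Y) -> convex_DLD2P (abs_sum (abs_norm_swap N) Y X).
Proof.
pose s (p : abs_sum N X Y) : abs_sum (abs_norm_swap N) Y X := (p.2, p.1).
have slin : linear s by [].
pose S : {linear abs_sum N X Y -> abs_sum (abs_norm_swap N) Y X} :=
  HB.pack s (GRing.isLinear.Build _ _ _ _ s slin).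
apply: (@convex_DLD2P_isometry _ _ _ _ S) => [p|[y x]]; last by exists (x, y).
by rewrite !rnorm_abs_sum.
Qed.

End swap.

Theorem proposition2 (R : realType) (k : scalar_kind)
    (X Y : completeNormedModType (scalars R k))
    (X_neq0 : exists x : X, x <> 0) (Y_neq0 : exists y : Y, y <> 0)
    (N : abs_norm R)
    (N_neq_max : ~ (forall a b : R, N a b = Num.max `|a| `|b|)) :
  convex_DLD2P (abs_sum N X Y) -> convex_DLD2P X /\ convex_DLD2P Y.
Proof.
move=> ZD; split; first exact: convex_DLD2P_fst ZD.
apply: (convex_DLD2P_fst Y_neq0 _ (convex_DLD2P_swap ZD)) => Nmax.
by apply: N_neq_max => a b; rewrite maxC -Nmax.
Qed.
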